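(* Let $\mathbf p\in\mathbb R^T$ be a given market price and, for every $i\in I$, let $N_i(\mathbf p,\mathbf x_i)$ be a real-valued function of $\mathbf x_i\in X_i$ such that \[ \pi_i^{st.+}(\mathbf p)=\max_{\mathbf x_i\in X_i}\bigl[\pi_i^{st.}(\mathbf p,\mathbf x_i)+N_i(\mathbf p,\mathbf x_i)\bigr], \] \[ \pi_i^{st.+}(\mathbf p)=\pi_i^{st.}(\mathbf p,\mathbf x_i^* )+N_i(\mathbf p,\mathbf x_i^* ), \] \[ N_i(\mathbf p,\mathbf x_i)\ge 0\quad\text{for all }\mathbf x_i\in X_i . \] Then: 1. the constraint $\sum_{i\in I}N_i(\mathbf p,\mathbf x_i)\ge 0$ is redundant on $\Omega$, i.e. it holds for every $\mathbf x\in\Omega$; 2. $v=1$ is an optimal point of the problem \[ \min_{\substack{v\ge 0\\ \text{s.t. } \pi_i^+(\mathbf p,v)=\pi_i^{st.+}(\mathbf p)\ \forall i\in I}}\ \sum_{i\in I}\bigl[\pi_i^+(\mathbf p,v)-\pi_i^*(\mathbf p,v)\bigr], \] and $\sum_{i\in I}\bigl[\pi_i^+(\mathbf p,1)-\pi_i^*(\mathbf p,1)\bigr]=0$, i.e. the total uplift payment vanishes.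
   Context: Setting: a $T$-period uninode power market with fixed load $\mathbf d\in\mathbb R_{\ge0}^T$ and a finite set $I$ of producers. For producer $i\in I$ and period $t\in\{1,\dots,T\}$, $u_i^t$ and $g_i^t$ are the (real) commitment and output variables; $\mathbf g_i=(g_i^1,\dots,g_i^T)$, $\mathbf u_i=(u_i^1,\dots,u_i^T)$, $x_i^t=(u_i^t,g_i^t)$, $\mathbf x_i=(x_i^1,\dots,x_i^T)$, $\mathbf x=(\mathbf x_i)_{i\in I}$. The private feasible set $X_i$ of producer $i$ (a set of possible $\mathbf x_i$) is nonempty and compact, and $C_i:X_i\to\mathbb R$ is its cost function. The centralized dispatch problem is \[ f^*=\min\Bigl\{\sum_{i\in I}C_i(\mathbf x_i)\ :\ \mathbf x_i\in X_i\ \forall i\in I,\ \sum_{i\in I}\mathbf g_i=\mathbf d\Bigr\}. \] Its feasible set is denoted $\Omega$ and is assumed nonempty; $\mathbf x^*=(\mathbf x_i^* )_{i\in I}$ denotes a fixed optimal point of this problem. For $\mathbf p\in\mathbb R^T$ define the producer profit $\pi_i^{st.}(\mathbf p,\mathbf x_i)=\mathbf p^T\mathbf g_i-C_i(\mathbf x_i)$ and its maximum $\pi_i^{st.+}(\mathbf p)=\max_{\mathbf x_i\in X_i}\pi_i^{st.}(\mathbf p,\mathbf x_i)$. Given functions $N_i(\mathbf p,\cdot)$ on $X_i$ and a multiplier $v\ge0$, define \[ \pi_i(\mathbf p,v,\mathbf x_i)=\pi_i^{st.}(\mathbf p,\mathbf x_i)+vN_i(\mathbf p,\mathbf x_i),\quad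 \pi_i^*(\mathbf p,v)=\pi_i(\mathbf p,v,\mathbf x_i^* ),\quad \pi_i^+(\mathbf p,v)=\max_{\mathbf x_i\in X_i}\pi_i(\mathbf p,v,\mathbf x_i). \] All maxima and minima in these definitions are assumed to be attained. The total uplift payment is $\sum_{i\in I}[\pi_i^+(\mathbf p,v)-\pi_i^*(\mathbf p,v)]$. *)

(* Defs.v *)
From mathcomp Require Import all_boot all_order all_algebra.
From mathcomp Require Import all_classical all_reals all_analysis.
Set Implicit Arguments.
Unset Strict Implicit.
Unset Printing Implicit Defensive.
Import Order.TTheory GRing.Theory Num.Theory.
Import numFieldNormedType.Exports.
Local Open Scope classical_set_scope.
Local Open Scope ring_scope.

(* A point x_i of a producer is stored as the pair (u_i, g_i) of its commitment
   and output vectors, i.e. with the coordinates of R^(2T) grouped by kind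
   rather than by period.  Cost functions and the functions N_i are total on
   this type, but below they are only ever evaluated on feasible points. *)
Notation plan R T := ('rV[R]_T * 'rV[R]_T)%type.

Section Optimization.
Variables (R : realType) (E : Type).

Definition attains_max (A : set E) (f : E -> R) : Prop :=
  exists2 x, A x & forall y, A y -> f y <= f x.

(* The maximum of f on A; meaningful only when [attains_max A f]. *)
Definition max_on (A : set E) (f : E -> R) : R := sup (f @` A).

Definition is_minimizer (A : set E) (f : E -> R) (x : E) : Prop :=
  A x /\ forall y, A y -> f x <= f y.

End Optimization.

Section Market.
Variables (R : realType) (T : nat).

Definition commitment (x : plan R T) : 'rV[R]_T := x.1.
Definition output (x : plan R T) : 'rV[R]_T := x.2.

Section Producer.
Variables (X : set (plan R T)) (C : plan R T -> R).
Variable N : 'rV[R]_T -> plan R T -> R.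

Definition profit_st (p : 'rV[R]_T) (x : plan R T) : R :=
  (\sum_(t < T) p 0 t * output x 0 t) - C x.

Definition profit_st_max (p : 'rV[R]_T) : R := max_on X (profit_st p).

Definition profit (p : 'rV[R]_T) (v : R) (x : plan R T) : R :=
  profit_st p x + v * N p x.

Definition profit_max (p : 'rV[R]_T) (v : R) : R := max_on X (profit p v).

End Producer.

Section Producers.
Variables (I : finType) (d : 'rV[R]_T).
Variables (X : I -> set (plan R T)) (C : I -> plan R T -> R).
Variable N : I -> 'rV[R]_T -> plan R T -> R.

(* The feasible set Omega of the centralized dispatch problem. *)
Definition dispatch_feasible : set (I -> plan R T) :=
  [set x | (forall i, X i (x i)) /\ \sum_(i : I) output (x i) = d].

Definition total_cost (x : I -> plan R T) : R := \sum_(i : I) C i (x i).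

Definition total_uplift (xstar : I -> plan R T) (p : 'rV[R]_T) (v : R) : R :=
  \sum_(i : I) (profit_max (X i) (C i) (N i) p v
                - profit (C i) (N i) p v (xstar i)).

Definition admissible_multipliers (p : 'rV[R]_T) : set R :=
  [set v | 0 <= v /\ forall i, profit_max (X i) (C i) (N i) p v
                               = profit_st_max (X i) (C i) p].

End Producers.
End Market.

(* Main.v *)
Require Import Defs.
From mathcomp Require Import all_boot all_order all_algebra.
From mathcomp Require Import all_classical all_reals all_analysis.
Import Order.TTheory GRing.Theory Num.Theory.
Import numFieldNormedType.Exports.
Local Open Scope classical_set_scope.
Local Open Scope ring_scope.

(** Every uplift term is nonnegative, since [xstar i] is itself feasible for
    producer [i]; at [v = 1] the two conditions on [N] make the maximal profit
    and the profit at [xstar i] both equal to the maximal standard profit. *)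

(** [max_on] is a supremum, which dominates the values of [f] only when they are bounded above; an
    attained maximum supplies this bound. *)
Lemma max_on_ge (R : realType) (E : Type) (A : set E) (f : E -> R) (x : E) :
  attains_max A f -> A x -> f x <= max_on A f.
Proof.
move=> [m Am fm] Ax; apply: ub_le_sup; last by exists x.
by exists (f m) => _ [y Ay <-]; exact: fm.
Qed.

Lemma total_uplift_ge0 (R : realType) (T : nat) (I : finType)
    (X : I -> set (plan R T)) (C : I -> plan R T -> R)
    (N : I -> 'rV[R]_T -> plan R T -> R) (x : I -> plan R T)
    (p : 'rV[R]_T) (v : R) :
  (forall i, attains_max (X i) (profit (C i) (N i) p v)) ->
  (forall i, X i (x i)) -> 0 <= total_uplift X C N x p v.
Proof.
move=> att Xx; apply: sumr_ge0 => i _; rewrite subr_ge0.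
exact: max_on_ge.
Qed.

Theorem mainTheorem1 (R : realType) (T : nat) (I : finType)
    (d : 'rV[R]_T)
    (X : I -> set (plan R T))
    (C : I -> plan R T -> R)
    (xstar : I -> plan R T)
    (p : 'rV[R]_T)
    (N : I -> 'rV[R]_T -> plan R T -> R)
    (load_ge0 : forall t, 0 <= d 0 t)
    (X_nonempty : forall i, X i !=set0)
    (X_compact : forall i, compact (X i))
    (Omega_nonempty : dispatch_feasible d X !=set0)
    (xstar_optimal :
       is_minimizer (dispatch_feasible d X) (total_cost C) xstar)
    (max_st_attained : forall i, attains_max (X i) (profit_st (C i) p))
    (max_attained : forall i (v : R), 0 <= v ->
       attains_max (X i) (profit (C i) (N i) p v))
    (N_max : forall i, profit_st_max (X i) (C i) p
       = max_on (X i) (fun x => profit_st (C i) p x + N i p x))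
    (N_star : forall i, profit_st_max (X i) (C i) p
       = profit_st (C i) p (xstar i) + N i p (xstar i))
    (N_ge0 : forall i x, X i x -> 0 <= N i p x) :
  (forall x, dispatch_feasible d X x -> 0 <= \sum_(i : I) N i p (x i)) /\
  is_minimizer (admissible_multipliers X C N p)
               (total_uplift X C N xstar p) 1 /\
  total_uplift X C N xstar p 1 = 0.
Proof.
have Xstar i : X i (xstar i) by have [[+ _] _] := xstar_optimal; apply.
(* Stated as an equality of functions so that it rewrites under [max_on] and matches the right-hand
   side of [N_max]. *)
have profit1 i : profit (C i) (N i) p 1
    = (fun x => profit_st (C i) p x + N i p x).
  by apply/funext => x; rewrite /profit mul1r.
have max1 i : profit_max (X i) (C i) (N i) p 1 = profit_st_max (X i) (C i) p.
  by rewrite /profit_max profit1 -N_max.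
have uplift1 : total_uplift X C N xstar p 1 = 0.
  (* Each term vanishes separately: [N_star] turns the maximum into the very expression that is
     subtracted. *)
  by apply: big1 => i _; rewrite max1 profit1 N_star subrr.
split; first by move=> x [Xx _]; apply: sumr_ge0 => i _; exact: N_ge0.
split=> //; split; first by split; [exact: ler01 | exact: max1].
(* As the uplift at 1 is 0, minimality amounts to nonnegativity at [v]; [v_ge0] ensures that the
   maxima at [v] are attained. *)
move=> v [v_ge0 _]; rewrite uplift1; apply: total_uplift_ge0 => // i.
exact: max_attained.
Qed.
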